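(* Let $(\overline{x},\overline{\lambda})$ be a KKT point of the unperturbed problem, i.e. $(\overline{x},\overline{\lambda})\in\mathcal{S}_{\rm KKT}(0,0)$. If $\mathcal{X}_{\rm KKT}$ has the pseudo-isolated calmness at the origin for $\overline{x}$ (with respect to $\overline{\lambda}$), then $\overline{\lambda}$ is noncritical.
   Context: Setting. $\mathbb{X},\mathbb{Y}$ are finite dimensional real vector spaces with inner product $\langle\cdot,\cdot\rangle$ and induced norm $\|\cdot\|$; $f:\mathbb{X}\to\mathbb{R}$ and $g:\mathbb{X}\to\mathbb{Y}$ are twice continuously differentiable; $\mathcal{K}\subseteq\mathbb{Y}$ is a nonempty closed convex set which is $C^2$-cone reducible: at every $\overline{y}\in\mathcal{K}$ there exist an open neighborhood $\mathcal{Y}$ of $\overline{y}$, a pointed closed convex cone $D$ in a finite dimensional space $\mathbb{Z}$, and a twice continuously differentiable $\Xi:\mathcal{Y}\to\mathbb{Z}$ with $\Xi(\overline{y})=0$, $\Xi'(\overline{y}):\mathbb{Y}\to\mathbb{Z}$ onto, and $\mathcal{K}\cap\mathcal{Y}=\{y\in\mathcal{Y}\mid\Xi(y)\in D\}$. The perturbed problem with parameter $(a,b)\in\mathbb{X}\times\mathbb{Y}$ is $\min_{x\in\mathbb{X}}\{f(x)-\langle a,x\rangle : g(x)-b\in\mathcal{K}\}$; the unperturbed problem has $(a,b)=(0,0)$. Notation. $h'(x)$ is the derivative of $h$ at $x$ and $\nabla h(x)$ its adjoint. $L(x,\lambda):=f(x)+\langle\lambda,g(x)\rangle$, so $\nabla_xL(x,\lambda)=\nabla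 f(x)+\nabla g(x)\lambda$; $\nabla^2_{xx}L$ is its Hessian in $x$. $\mathcal{N}_{\mathcal{K}}$ is the normal cone of convex analysis; $\mathbb{B}_{\delta}(z)$ is the closed ball of radius $\delta$ centered at $z$. KKT mappings. $\mathcal{S}_{\rm KKT}(a,b):=\{(x,\lambda)\in\mathbb{X}\times\mathbb{Y}\mid\nabla_xL(x,\lambda)=a,\ \lambda\in\mathcal{N}_{\mathcal{K}}(g(x)-b)\}$; $\mathcal{X}_{\rm KKT}(a,b):=\{x\in\mathbb{X}\mid\exists\lambda\in\mathbb{Y},\ (x,\lambda)\in\mathcal{S}_{\rm KKT}(a,b)\}$; $\mathcal{M}(x,a,b):=\{\lambda\in\mathbb{Y}\mid(x,\lambda)\in\mathcal{S}_{\rm KKT}(a,b)\}$. Pseudo-isolated calmness. For $\overline{\lambda}\in\mathcal{M}(\overline{x},0,0)$, $\mathcal{X}_{\rm KKT}$ has the pseudo-isolated calmness at the origin for $\overline{x}$ (the multiplier $\overline{\lambda}$ being fixed) if there exist $\varepsilon,\delta,\kappa>0$ such that for any $(a,b)$ with $\|(a,b)\|\le\delta$ and any $(x,\lambda)\in\mathcal{S}_{\rm KKT}(a,b)\cap\mathbb{B}_{\varepsilon}((\overline{x},\overline{\lambda}))$, $\|x-\overline{x}\|\le\kappa\|(a,b)\|$. Noncriticality. For a multifunction $\mathcal{F}$, the graphical derivative is defined by $\Delta w\in D\mathcal{F}(\overline{z}|\overline{w})(\Delta z)$ iff $(\Delta z,\Delta w)$ belongs to the contingent cone of ${\rm gph}\,\mathcal{F}$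 at $(\overline{z},\overline{w})$. The multiplier $\overline{\lambda}\in\mathcal{M}(\overline{x},0,0)$ is noncritical if $\xi=0$ is the only solution of $0\in\nabla^2_{xx}L(\overline{x},\overline{\lambda})\xi+\nabla g(\overline{x})D\mathcal{N}_{\mathcal{K}}(g(\overline{x})|\overline{\lambda})(g'(\overline{x})\xi)$. *)

(* Defs.v *)
From HB Require Import structures.
From mathcomp Require Import all_boot all_order all_algebra sesquilinear.
From mathcomp Require Import all_classical all_reals all_analysis.

Set Implicit Arguments.
Unset Strict Implicit.
Unset Printing Implicit Defensive.

Import Order.TTheory GRing.Theory Num.Theory.
Import numFieldNormedType.Exports.

Local Open Scope classical_set_scope.
Local Open Scope ring_scope.

(* Finite-dimensional real vector spaces with an inner product and the norm
   it induces. *)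
HB.mixin Record NormedVector_isEuclidean (R : realType) (V : Type)
    & NormedModule R V & Vector R V := {
  inner : {dot V for @idfun R};
  sqr_norm_inner : forall x : V, `|x| ^+ 2 = inner x x
}.

#[short(type="euclideanType")]
HB.structure Definition Euclidean (R : realType) :=
  {V of NormedModule R V & Vector R V & NormedVector_isEuclidean R V}.

Section scalars.
Context (R : realType).

Definition scalar_inner (x y : R^o) : R := x * y.

Let scalar_inner_bilinear :
  bilinear_for (GRing.Scale.Law.clone _ _ *%R _)
               (GRing.Scale.Law.clone _ _ (@idfun R \; *%R) _) scalar_inner.
Proof.
split=> [z a x y|z a x y]; rewrite /scalar_inner /=.
  by rewrite mulrDl -mulrA.
by rewrite mulrDr mulrCA.
Qed.

HB.instance Definition _ :=
  bilinear_isBilinear.Build R R^o R^o R _ _ scalar_inner scalar_inner_bilinear.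

Let scalar_inner_sym (x y : R^o) :
  scalar_inner x y = (-1) ^+ false * idfun (scalar_inner y x).
Proof. by rewrite expr0 mul1r /scalar_inner mulrC. Qed.

HB.instance Definition _ :=
  isHermitianSesquilinear.Build R R^o false (@idfun R) scalar_inner
    scalar_inner_sym.

Let scalar_inner_gt0 (u : R^o) : u != 0 -> 0 < scalar_inner u u.
Proof. by move=> u0; rewrite /scalar_inner -expr2 exprn_even_gt0. Qed.

HB.instance Definition _ :=
  isDotProduct.Build R R^o scalar_inner scalar_inner_gt0.

Let scalar_sqr_norm (x : R^o) : `|x| ^+ 2 = scalar_inner x x.
Proof. by rewrite -normrX ger0_norm ?sqr_ge0// expr2. Qed.

HB.instance Definition _ :=
  NormedVector_isEuclidean.Build R R^o scalar_sqr_norm.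

End scalars.

Section calculus.
Context {R : realType}.

Definition adjoint (X Y : euclideanType R) (A : {linear X -> Y}) (y : Y) : X :=
  get [set x : X | forall v, inner x v = inner y (A v)].

Section riesz.
Variable X : euclideanType R.

Definition inner_functional (x v : X) : R^o := inner x v.

Let inner_functional_linear (x : X) : linear (inner_functional x).
Proof.
by move=> a u v; rewrite /inner_functional linearD /= linearZr_LR; reflexivity.
Qed.

HB.instance Definition _ (x : X) :=
  GRing.isLinear.Build R X R^o _ (inner_functional x)
    (inner_functional_linear x).

Definition riesz_map (x : X) : 'Hom(X, R^o) := linfun (inner_functional x).

Let riesz_map_linear : linear riesz_map.
Proof.
move=> a u v; apply/lfunP => w; rewrite add_lfunE scale_lfunE !lfunE /=.
by rewrite /inner_functional linearDl /= linearZl_LR; reflexivity.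
Qed.

HB.instance Definition _ :=
  GRing.isLinear.Build R X 'Hom(X, R^o) _ riesz_map riesz_map_linear.

Lemma riesz (phi : {linear X -> R^o}) :
  exists x : X, forall v, inner x v = phi v.
Proof.
have kerT : lker (linfun riesz_map) = 0%VS.
  apply/eqP/lker0P => u v; rewrite !lfunE => /lfunP /(_ (u - v)).
  rewrite !lfunE /= /inner_functional => uv.
  apply/eqP; rewrite -subr_eq0 -normr_eq0 -sqrf_eq0.
  by rewrite sqr_norm_inner linearBl /= uv subrr eqxx.
have imgT : limg (linfun riesz_map) = fullv.
  apply/eqP; rewrite eqEdim subvf /= limg_dim_eq ?kerT ?capv0//.
  by rewrite !dimvf /dim /= muln1.
have : linfun phi \in limg (linfun riesz_map) by rewrite imgT memvf.
case/memv_imgP => x _ e; exists x => v.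
move: e; rewrite lfunE /= => /lfunP /(_ v).
by rewrite (lfunE (inner_functional x)) lfunE.
Qed.

End riesz.

Lemma adjointE (X Y : euclideanType R) (A : {linear X -> Y}) (y : Y) (v : X) :
  inner (adjoint A y) v = inner y (A v).
Proof.
have lin : linear (fun w => inner y (A w) : R^o).
  by move=> a u w; rewrite !linearP; reflexivity.
pose phi := GRing.isLinear.Build R X R^o _ _ lin.
pose F : {linear X -> R^o} := HB.pack (fun w => inner y (A w) : R^o) phi.
have [x xE] := riesz F.
exact: (@getPex _ [set x : X | forall v, inner x v = inner y (A v)] (ex_intro _ x xE)).
Qed.

(* The adjoint of h'(x) : X -> R, identified with its value at 1. *)
Definition grad (X : euclideanType R) (h : X -> R^o) (x : X) : X :=
  adjoint ('d h x) (1 : R^o).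

(* k times continuously differentiable on the open set U. The domain being
   finite dimensional, x |-> 'd h x is C^k for the operator norm iff
   x |-> 'd h x v is C^k for every v. *)
Fixpoint Ck_on (k : nat) (V W : euclideanType R) (U : set V) (h : V -> W) :=
  if k is k'.+1 then
    (forall x, U x -> differentiable h x) /\
    (forall v, Ck_on k' U (fun x => 'd h x v))
  else forall x, U x -> {for x, continuous h}.

End calculus.

Section variational_analysis.
Context {R : realType}.

Definition normal_cone (Y : euclideanType R) (K : set Y) (y : Y) : set Y :=
  [set lam | K y /\ forall z, K z -> inner lam (z - y) <= 0].

Definition contingent_cone (V : normedModType R) (A : set V) (z : V) : set V :=
  [set w | exists (t : R^nat) (u : V^nat),
    [/\ forall k, 0 < t k, t @ \oo --> 0, u @ \oo --> w &
        forall k, A (z + t k *: u k)]].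

Definition graph (V W : Type) (F : V -> set W) : set (V * W) :=
  [set p | F p.1 p.2].

Definition graph_deriv (V W : normedModType R) (F : V -> set W) (z : V) (w : W)
    (dz : V) : set W :=
  [set dw | contingent_cone (graph F) (z, w) (dz, dw)].

Definition pointed_closed_convex_cone (Z : euclideanType R) (D : set Z) :=
  [/\ closed D, convex_set D,
      forall t d, 0 <= t -> D d -> D (t *: d) &
      [set d | D d /\ D (- d)] = [set 0]].

(* Xi is only used on the open set U; its values elsewhere are irrelevant. *)
Definition C2_cone_reducible (Y : euclideanType R) (K : set Y) :=
  forall y, K y -> exists (Z : euclideanType R) (U : set Y) (D : set Z)
    (Xi : Y -> Z),
    [/\ open_nbhs y U, pointed_closed_convex_cone D & Ck_on 2 U Xi] /\
    [/\ Xi y = 0, range ('d Xi y) = setT &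
        K `&` U = [set u | U u /\ D (Xi u)]].

End variational_analysis.

Section kkt.
Context {R : realType} {X Y : euclideanType R}.
Variables (f : X -> R^o) (g : X -> Y) (K : set Y).

(* The library's norm on X * Y is the max norm. *)
Definition pair_norm (p : X * Y) : R :=
  Num.sqrt (`|p.1| ^+ 2 + `|p.2| ^+ 2).

Definition lagrangian (x : X) (lam : Y) : R^o := f x + inner lam (g x).

Definition grad_lagrangian (x : X) (lam : Y) : X :=
  grad (lagrangian ^~ lam) x.

Definition hess_lagrangian (x : X) (lam : Y) : {linear X -> X} :=
  'd (grad_lagrangian ^~ lam) x.

(* (x, lam) \in S_KKT(a, b) is  S_KKT (a, b) (x, lam). *)
Definition S_KKT (ab : X * Y) : set (X * Y) :=
  [set z | grad_lagrangian z.1 z.2 = ab.1 /\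
           normal_cone K (g z.1 - ab.2) z.2].

Definition pseudo_isolated_calm (x : X) (lam : Y) :=
  exists eps delta kappa : R,
    [/\ 0 < eps, 0 < delta & 0 < kappa] /\
    forall ab : X * Y, pair_norm ab <= delta ->
    forall z : X * Y, S_KKT ab z -> pair_norm (z - (x, lam)) <= eps ->
      `|z.1 - x| <= kappa * pair_norm ab.

Definition noncritical (x : X) (lam : Y) :=
  [set xi | [set hess_lagrangian x lam xi + adjoint ('d g x) eta |
             eta in graph_deriv (normal_cone K) (g x) lam ('d g x xi)] 0]
  = [set 0].

End kkt.

(* Main.v *)
Require Import Defs.
From mathcomp Require Import all_boot all_order all_algebra.
From mathcomp Require Import sesquilinear ring.
From mathcomp Require Import all_classical all_reals all_analysis.

(** A nonzero solution xi of the criticality inclusion comes with t_k -> 0 and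
    (u_k, v_k) -> (g'(x) xi, eta) such that lam + t_k v_k is normal to K at
    g(x) + t_k u_k. Then (x + t_k xi, lam + t_k v_k) solves the KKT system for
    the perturbation a_k = grad L(x + t_k xi, lam + t_k v_k) and
    b_k = g(x + t_k xi) - g(x) - t_k u_k. Both are o(t_k), the first because
    a_k / t_k tends to the left-hand side of the inclusion, whereas the primal
    point moves by t_k |xi|; this contradicts calmness. *)

Set Implicit Arguments.
Unset Strict Implicit.
Unset Printing Implicit Defensive.

Import Order.TTheory GRing.Theory Num.Theory.
Import numFieldNormedType.Exports.

Local Open Scope classical_set_scope.
Local Open Scope ring_scope.

(** * Continuity, convergence and differentiability tested through inner products *)

Section inner_product.
Context {R : realType} (V : euclideanType R).
Implicit Types u v w : V.

Lemma innerC u v : inner u v = inner v u.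
Proof. by rewrite hermC expr0 mul1r. Qed.

Lemma innerZl (a : R) u v : inner (a *: u) v = a * inner u v.
Proof. exact: linearZl_LR. Qed.

Lemma inner0l u : inner 0 u = 0.
Proof. exact: linear0l. Qed.

Lemma innerDl u v w : inner (u + v) w = inner u w + inner v w.
Proof. exact: linearDl. Qed.

Lemma innerDr u v w : inner u (v + w) = inner u v + inner u w.
Proof. exact: linearDr. Qed.

Lemma innerNl u v : inner (- u) v = - inner u v.
Proof. exact: linearNl. Qed.

Lemma innerNr u v : inner u (- v) = - inner u v.
Proof. exact: linearNr. Qed.

(** Brings the continuity of the inner product down to that of the norm. *)
Lemma inner_polarization u v :
  inner u v = (`|u + v| ^+ 2 - `|u - v| ^+ 2) / 4.
Proof.
rewrite !sqr_norm_inner !(innerDl, innerDr, innerNl, innerNr) (innerC v u).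
by field.
Qed.

Lemma cvg_inner {T : Type} (F : set_system T) (FF : Filter F)
    (p q : T -> V) (u v : V) :
  p @ F --> u -> q @ F --> v -> inner (p t) (q t) @[t --> F] --> inner u v.
Proof.
move=> pu qv; rewrite inner_polarization.
under eq_fun do rewrite inner_polarization.
apply: cvgM; last exact: cvg_cst.
apply: cvgB; rewrite expr2; under eq_fun do rewrite expr2.
  by apply: cvgM; apply: cvg_norm; exact: cvgD.
by apply: cvgM; apply: cvg_norm; exact: cvgB.
Qed.

Lemma continuous_inner u : continuous (inner_functional u : V -> R^o).
Proof. by move=> v; apply: cvg_inner; [exact: cvg_cst|exact: cvg_id]. Qed.

Lemma inner_ext u v : (forall w, inner u w = inner v w) -> u = v.
Proof.
move=> uv; apply/eqP; rewrite -subr_eq0 -normr_eq0 -sqrf_eq0.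
by rewrite sqr_norm_inner innerDl innerNl uv subrr.
Qed.

(** The coordinates in a basis [e] are linear functionals, and [riesz] represents each of them by
    some [c i]. *)
Lemma inner_frame : exists (n : nat) (c e : 'I_n -> V),
  forall v, v = \sum_i inner (c i) v *: e i.
Proof.
pose phi i : {linear V -> R^o} := coord (vbasis (fullv : {vspace V})) i.
have /choice[c cE] i := riesz (phi i).
exists (\dim (fullv : {vspace V})), c, (fun i => (vbasis fullv)`_i) => v.
rewrite [LHS](coord_vbasis (memvf v)); apply: eq_bigr => i _.
by rewrite cE.
Qed.

(** By [inner_frame] a vector is a finite sum of fixed vectors weighted by inner products. This
    suits adjoints and gradients, which are known only through their inner products. *)
Lemma weak_cvg {T : Type} (F : set_system T) (FF : Filter F)
    (p : T -> V) (u : V) :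
  (forall w, inner w (p t) @[t --> F] --> inner w u) -> p @ F --> u.
Proof.
move=> pu; have [n [c [e ce]]] := inner_frame.
rewrite (ce u).
have -> : p = fun t => \sum_i inner (c i) (p t) *: e i by exact/funext.
apply: cvg_big => [|i _]; first exact: add_continuous.
by apply: cvgZr_tmp; exact: pu.
Qed.

Lemma weak_differentiable (W : normedModType R) (h : W -> V) (x : W) :
  (forall w, differentiable (fun z => inner w (h z) : R^o) x) ->
  differentiable h x.
Proof.
move=> dh; have [n [c [e ce]]] := inner_frame.
have -> : h = \sum_i (fun z => inner (c i) (h z) *: e i).
  by apply/funext => z; rewrite fct_sumE -ce.
by apply: differentiable_sum => i; apply: differentiableZl; exact: dh.
Qed.

End inner_product.

Lemma pair_norm_le {R : realType} (X Y : euclideanType R) (p : X * Y) :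
  pair_norm p <= `|p.1| + `|p.2|.
Proof.
rewrite -(ger0_norm (addr_ge0 (normr_ge0 p.1) (normr_ge0 p.2))) -sqrtr_sqr.
by apply: ler_wsqrtr; rewrite sqrrD lerD2r lerDl mulrn_wge0.
Qed.

(** The directional derivative is a limit over the punctured neighbourhoods of 0; positivity makes
    [t] converge in that filter. *)
Lemma differentiable_cvg_quotient {R : realType} (V W : normedModType R)
    (h : V -> W) (x v : V) (t : R^nat) :
  differentiable h x -> (forall k, 0 < t k) -> t @ \oo --> 0 ->
  (t k)^-1 *: (h (x + t k *: v) - h x) @[k --> \oo] --> 'd h x v.
Proof.
move=> dh t_gt0 t0.
have t0' : t @ \oo --> 0^'.
  move=> A /= /t0 [n _ nA]; exists n => // k nk.
  by apply: nA => //=; rewrite gt_eqF.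
have hv : h'^-1 *: ((h \o shift x) (h' *: v) - h x) @[h' --> 0^'] --> 'd h x v.
  rewrite -deriveE//; exact: diff_derivable.
have := cvg_comp _ _ t0' hv; apply: cvg_trans; apply: near_eq_cvg.
by apply: nearW => k; rewrite /= (addrC _ x).
Qed.

(** Paired with [w], the adjoint becomes [inner (p t) (A t w)], so pointwise convergence of the
    operators is enough. *)
Lemma cvg_adjoint {R : realType} {X Y : euclideanType R} {T : Type}
    (F : set_system T) (FF : Filter F)
    (A : T -> {linear X -> Y}) (B : {linear X -> Y}) (p : T -> Y) (y : Y) :
  (forall w, A t w @[t --> F] --> B w) -> p @ F --> y ->
  adjoint (A t) (p t) @[t --> F] --> adjoint B y.
Proof.
move=> AB py; apply: weak_cvg => w; rewrite innerC adjointE.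
rewrite (_ : (fun t => inner w (adjoint (A t) (p t))) =
             fun t => inner (p t) (A t w)).
  exact: cvg_inner.
by apply/funext => t; rewrite innerC adjointE.
Qed.

(** * Gradient of the Lagrangian and its first-order expansion *)

Section lagrangian.
Context {R : realType} {X Y : euclideanType R}.
Variables (f : X -> R^o) (g : X -> Y).
Hypotheses (f_C2 : Ck_on 2 setT f) (g_C2 : Ck_on 2 setT g).

Let df x : differentiable f x. Proof. by case: f_C2 => + _; apply. Qed.
Let dg x : differentiable g x. Proof. by case: g_C2 => + _; apply. Qed.
Let ddf v x : differentiable (fun z => 'd f z v) x.
Proof. by case: f_C2 => _ /(_ v)[+ _]; apply. Qed.
Let ddg v x : differentiable (fun z => 'd g z v) x.
Proof. by case: g_C2 => _ /(_ v)[+ _]; apply. Qed.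

Lemma inner_grad_lagrangian x lam v :
  inner (grad_lagrangian f g x lam) v = 'd f x v + inner lam ('d g x v).
Proof.
have cl := @continuous_inner _ Y lam.
rewrite /grad_lagrangian /grad adjointE.
(* The gradient is the adjoint at 1, and the inner product of the scalars is multiplication. *)
rewrite [LHS](_ : _ = 'd (lagrangian f g ^~ lam) x v); last exact: mul1r.
rewrite (_ : lagrangian f g ^~ lam = f + (inner_functional lam \o g))//.
have dl : differentiable (inner_functional lam : Y -> R^o) (g x).
  exact: linear_differentiable.
rewrite diffD//=; last exact: differentiable_comp.
by rewrite (diff_comp (dg x) dl) /= (diff_lin (g x) cl).
Qed.

Lemma differentiable_grad_lagrangian x lam :
  differentiable (grad_lagrangian f g ^~ lam) x.
Proof.
apply: weak_differentiable => w.
have cl := @continuous_inner _ Y lam.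
rewrite (_ : (fun z => _) =
  (fun z => 'd f z w) + (inner_functional lam \o (fun z => 'd g z w))).
  apply: differentiableD => //; apply: differentiable_comp => //.
  exact: linear_differentiable.
by apply/funext => z; rewrite innerC inner_grad_lagrangian.
Qed.

Lemma grad_lagrangianD x lam mu :
  grad_lagrangian f g x (lam + mu) =
  grad_lagrangian f g x lam + adjoint ('d g x) mu.
Proof.
apply: inner_ext => w.
rewrite (inner_grad_lagrangian x (lam + mu)) (innerDl lam) addrA.
rewrite (innerDl (grad_lagrangian f g x lam)) (inner_grad_lagrangian x lam).
by rewrite adjointE.
Qed.

Lemma adjointZ (A : {linear X -> Y}) (a : R) y :
  adjoint A (a *: y) = a *: adjoint A y.
Proof. by apply: inner_ext => w; rewrite innerZl !adjointE innerZl. Qed.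

(** The gradient is affine in the multiplier, so the quotient splits into a difference quotient in
    [x] at fixed [lam], which tends to the Hessian term, and the adjoint of g' at the moving point
    applied to [v k]. The latter converges because g' is continuous. *)
Lemma cvg_grad_lagrangian_quotient x lam xi eta (t : R^nat) (v : Y^nat) :
  (forall k, 0 < t k) -> t @ \oo --> 0 -> v @ \oo --> eta ->
  (t k)^-1 *: (grad_lagrangian f g (x + t k *: xi) (lam + t k *: v k) -
               grad_lagrangian f g x lam) @[k --> \oo] -->
  hess_lagrangian f g x lam xi + adjoint ('d g x) eta.
Proof.
move=> t_gt0 t0 veta.
rewrite (_ : (fun k => _) = (fun k =>
  (t k)^-1 *: (grad_lagrangian f g (x + t k *: xi) lam -
               grad_lagrangian f g x lam) +
  adjoint ('d g (x + t k *: xi)) (v k))).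
  apply: cvgD.
    apply: differentiable_cvg_quotient => //.
    exact: differentiable_grad_lagrangian.
  apply: cvg_adjoint => // w.
  have xk : x + t k *: xi @[k --> \oo] --> x.
    rewrite -[X in _ --> X]addr0 -(scale0r xi).
    by apply: cvgD; [exact: cvg_cst|exact: cvgZr_tmp].
  exact: (cvg_comp _ _ xk (differentiable_continuous (ddg w x))).
apply/funext => k; rewrite grad_lagrangianD adjointZ addrAC scalerDr scalerA.
by rewrite mulVf ?scale1r// gt_eqF.
Qed.

End lagrangian.

Theorem proposition4p1 (R : realType) (X Y : euclideanType R)
    (f : X -> R^o) (g : X -> Y) (K : set Y)
    (f_C2 : Ck_on 2 setT f) (g_C2 : Ck_on 2 setT g)
    (K_nonempty : K !=set0) (K_closed : closed K) (K_convex : convex_set K)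
    (K_reducible : C2_cone_reducible K)
    (x : X) (lam : Y)
    (x_lam_KKT : S_KKT f g K (0, 0) (x, lam))
    (x_lam_calm : pseudo_isolated_calm f g K x lam) :
  noncritical f g K x lam.
Proof.
have [/= grad0 ncone] := x_lam_KKT; rewrite subr0 in ncone.
apply/seteqP; split => xi; last first.
  move=> ->; exists 0; last first.
    rewrite !linear0 add0r; apply: inner_ext => w.
    by rewrite adjointE !inner0l.
  (* The zero direction is tangent to the graph at its point [(g x, lam)]; any positive null
     sequence serves. *)
  rewrite linear0; exists (fun k => k.+1%:R^-1), (cst 0); split => //.
  - exact: cvg_harmonic.
  - exact: cvg_cst.
  - by move=> k; rewrite scaler0 addr0.
move=> [eta [t [uv [t_gt0 t0 uv_cvg uv_graph]]] stat].
have u_cvg : (uv k).1 @[k --> \oo] --> 'd g x xi.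
  exact: (cvg_comp _ _ uv_cvg cvg_fst).
have v_cvg : (uv k).2 @[k --> \oo] --> eta.
  exact: (cvg_comp _ _ uv_cvg cvg_snd).
pose xk k := x + t k *: xi.
pose lamk k := lam + t k *: (uv k).2.
pose ak k := grad_lagrangian f g (xk k) (lamk k).
pose bk k := g (xk k) - (g x + t k *: (uv k).1).
have KKTk k : S_KKT f g K (ak k, bk k) (xk k, lamk k).
  split => //=; rewrite /bk subKr; exact: uv_graph.
have a0 : (t k)^-1 *: ak k @[k --> \oo] --> 0.
  have := cvg_grad_lagrangian_quotient f_C2 g_C2 (x := x) (lam := lam)
    (xi := xi) t_gt0 t0 v_cvg.
  by rewrite stat grad0; under eq_fun do rewrite subr0.
have b0 : (t k)^-1 *: bk k @[k --> \oo] --> 0.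
  (* The quotient is the difference quotient of [g] along [xi] minus the first component of [uv k];
     both tend to ['d g x xi]. *)
  rewrite -(subrr ('d g x xi)).
  rewrite (_ : (fun k => _) = (fun k =>
    (t k)^-1 *: (g (xk k) - g x) - (uv k).1)).
    apply: cvgB => //; apply: differentiable_cvg_quotient => //.
    by case: g_C2 => + _; apply.
  apply/funext => k; rewrite /bk opprD addrA scalerBr scalerA.
  by rewrite mulVf ?scale1r// gt_eqF.
have [eps [delta [kappa [[eps0 delta0 kappa0] calm]]]] := x_lam_calm.
(* A null sequence that bounds the size of the perturbation divided by [t k]. *)
pose rk k := `|(t k)^-1 *: ak k| + `|(t k)^-1 *: bk k|.
have rk0 : rk @ \oo --> 0.
  rewrite -(addr0 0) -[X in X + _](@normr0 _ X) -[X in _ + X](@normr0 _ Y).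
  by apply: cvgD; exact: cvg_norm.
have pair_le k : pair_norm (ak k, bk k) <= t k * rk k.
  apply: (le_trans (pair_norm_le _)) => /=.
  rewrite /rk !normrZ normfV gtr0_norm// mulrDr !mulrA mulfV ?gt_eqF//.
  by rewrite !mul1r.
have ab_small : \forall k \near \oo, pair_norm (ak k, bk k) <= delta.
  have : t k * rk k @[k --> \oo] --> 0 by rewrite -(mulr0 0); exact: cvgM.
  move/cvgr_le => /(_ _ delta0); apply: filterS => k.
  exact: le_trans.
(* Calmness is local also in the multiplier; the displacement is at most [t k] times a convergent
   sequence. *)
have z_small : \forall k \near \oo,
    pair_norm ((xk k, lamk k) - (x, lam)) <= eps.
  have : t k * (`|xi| + `|(uv k).2|) @[k --> \oo] --> 0.
    rewrite -(mul0r (`|xi| + `|eta|)); apply: cvgM => //.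
    by apply: cvgD; [exact: cvg_cst|exact: cvg_norm].
  move/cvgr_le => /(_ _ eps0); apply: filterS => k; apply: le_trans.
  apply: (le_trans (pair_norm_le _)) => /=.
  rewrite /xk /lamk !(addrAC _ _ (- _)) !subrr !add0r !normrZ gtr0_norm//.
  by rewrite mulrDr.
(* Calmness bounds [t k] times the norm of [xi] by [kappa * (t k * rk k)], and [t k] cancels. *)
have xi_le : \forall k \near \oo, `|xi| <= kappa * rk k.
  near=> k.
  have : `|xk k - x| <= kappa * pair_norm (ak k, bk k).
    by apply: (calm _ _ _ (KKTk k)); near: k.
  rewrite /xk addrAC subrr add0r normrZ gtr0_norm// => h.
  rewrite -(ler_pM2l (t_gt0 k)) (le_trans h)// mulrCA ler_wpM2l//.
  exact: ltW.
have : `|xi| <= 0.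
  have : kappa * rk k @[k --> \oo] --> 0.
    by rewrite -(mulr0 kappa); apply: cvgM => //; exact: cvg_cst.
  move=> h; rewrite -(cvg_lim _ h)//; apply: limr_ge => //.
  by apply/cvg_ex; exists 0.
by rewrite normr_le0 => /eqP.
Unshelve. all: by end_near. Qed.
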